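(* Let $\Gamma$ be a finitely presented group. Then there exist an integer $g\ge 0$, free groups $\Gamma_0,\Gamma_1,\Gamma_2$ each of rank at most $g$, and, with $\Gamma_g$ denoting the fundamental group of a closed orientable surface of genus $g$, epimorphisms $\psi_k:\Gamma_g\to\Gamma_k$ for $k=0,1,2$, such that $\Gamma$ is isomorphic to the fundamental group of the following generalised graph of groups: the underlying graph is a tree with four vertices, namely a central vertex with vertex group $\Gamma_g$ and three outer vertices with vertex groups $\Gamma_0,\Gamma_1,\Gamma_2$; for each $k\in\{0,1,2\}$ there is exactly one edge, oriented from the central vertex to the vertex of $\Gamma_k$, with edge group $\Gamma_g$ and with edge homomorphisms the identity $\Gamma_g\to\Gamma_g$ at the central vertex and $\psi_k:\Gamma_g\to\Gamma_k$ at the outer vertex.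
   Context: A generalised graph of groups is defined exactly as a graph of groups, except that the homomorphisms from edge groups to vertex groups need not be injective. Its fundamental group is defined by the same presentation as for graphs of groups. When the underlying graph is a tree, it is the quotient of the free product of the vertex groups by the relations $\alpha_e(x)=\beta_e(x)$ for all edges $e$ and all $x$ in the edge group of $e$, where $\alpha_e,\beta_e$ are the two homomorphisms from the edge group to the vertex groups at the two ends of $e$ (that is, it is the colimit of the diagram of groups). *)

(* Defs.v *)
From HB Require Import structures.
From mathcomp Require Import all_boot.
From mathcomp Require Import boolp classical_sets.

Set Implicit Arguments.
Unset Strict Implicit.
Unset Printing Implicit Defensive.

Local Open Scope group_scope.
Local Open Scope quotient_scope.

(* A multiplicative map between groupTypes is a group homomorphism. *)
Definition isomorphic (G H : groupType) : Prop :=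
  exists f : {multiplicative G -> H}, bijective f.

(* The letter (x, false) stands for the generator x, (x, true) for x^-1. *)
Definition word (X : choiceType) : Type := seq (X * bool).

Definition letter_inv (X : choiceType) (a : X * bool) : X * bool :=
  (a.1, ~~ a.2).

Definition word_inv (X : choiceType) (w : word X) : word X :=
  rev (map (@letter_inv X) w).

Section Presentation.
Variables (X : choiceType) (R : set (word X)).

Inductive pres_eq : word X -> word X -> Prop :=
| pres_refl u : pres_eq u u
| pres_sym u v : pres_eq u v -> pres_eq v u
| pres_trans v u w : pres_eq u v -> pres_eq v w -> pres_eq u w
| pres_cat u u' v v' : pres_eq u u' -> pres_eq v v' ->
    pres_eq (u ++ v) (u' ++ v')
| pres_cancel a : pres_eq [:: a; letter_inv a] [::]
| pres_rel r : R r -> pres_eq r [::].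

Definition pres_eqb : rel (word X) := fun u v => `[< pres_eq u v >].

Lemma pres_eqb_refl : reflexive pres_eqb.
Proof. by move=> u; apply/asboolP; apply: pres_refl. Qed.

Lemma pres_eqb_sym : symmetric pres_eqb.
Proof. by move=> u v; apply/asboolP/asboolP; apply: pres_sym. Qed.

Lemma pres_eqb_trans : transitive pres_eqb.
Proof.
move=> v u w /asboolP uv /asboolP vw; apply/asboolP.
exact: pres_trans uv vw.
Qed.

Canonical pres_equiv := EquivRel pres_eqb
  pres_eqb_refl pres_eqb_sym pres_eqb_trans.

(* The group < X | R >. *)
Definition presented : Type := {eq_quot pres_equiv}.
HB.instance Definition _ := Choice.copy presented {eq_quot pres_equiv}.

Definition pres_class (w : word X) : presented := \pi_({eq_quot pres_equiv}) w.
Definition pres_repr (x : presented) : word X := repr (x : {eq_quot pres_equiv}).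

Lemma pres_reprK : cancel pres_repr pres_class.
Proof. by move=> x; rewrite /pres_class /pres_repr reprK. Qed.

Lemma pres_classP u v : pres_class u = pres_class v <-> pres_eq u v.
Proof.
split=> [uv | uv].
  by apply/asboolP; move/eqmodP: uv.
by apply/eqmodP; apply/asboolP.
Qed.

Lemma pres_repr_class w : pres_eq (pres_repr (pres_class w)) w.
Proof. by apply/pres_classP; rewrite pres_reprK. Qed.

Lemma pres_invl (w : word X) : pres_eq (word_inv w ++ w) [::].
Proof.
elim/last_ind: w => [|w a IH]; first exact: pres_refl.
rewrite /word_inv map_rcons rev_rcons -/(word_inv w) -cats1 cat_cons catA.
have h : pres_eq [:: letter_inv a; a] [::].
  have := pres_cancel (letter_inv a).
  by rewrite /letter_inv /= negbK -surjective_pairing.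
apply: pres_trans h; apply: (@pres_cat [:: _] [:: _] _ [:: a] (pres_refl _)).
exact: (pres_cat IH (pres_refl _)).
Qed.

Lemma pres_invr (w : word X) : pres_eq (w ++ word_inv w) [::].
Proof.
elim: w => [|a w IH]; first exact: pres_refl.
rewrite /word_inv map_cons rev_cons -cats1 -/(word_inv w) cat_cons catA.
apply: pres_trans (pres_cancel a).
apply: (@pres_cat [:: a] [:: a] _ [:: letter_inv a] (pres_refl _)).
exact: (pres_cat IH (pres_refl _)).
Qed.

Definition pres_one : presented := pres_class [::].
Definition pres_mul (x y : presented) : presented :=
  pres_class (pres_repr x ++ pres_repr y).
Definition pres_inv (x : presented) : presented :=
  pres_class (word_inv (pres_repr x)).

Lemma pres_class_cat u v :
  pres_mul (pres_class u) (pres_class v) = pres_class (u ++ v).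
Proof. by apply/pres_classP; apply: pres_cat; apply: pres_repr_class. Qed.

Lemma pres_mulA : associative pres_mul.
Proof.
move=> x y z; rewrite -[x]pres_reprK -[y]pres_reprK -[z]pres_reprK.
by rewrite !pres_class_cat catA.
Qed.

Lemma pres_mul1 : left_id pres_one pres_mul.
Proof. by move=> x; rewrite -[x]pres_reprK pres_class_cat. Qed.

Lemma pres_mulr1 : right_id pres_one pres_mul.
Proof. by move=> x; rewrite -[x]pres_reprK pres_class_cat cats0. Qed.

Lemma pres_mulV : left_inverse pres_one pres_inv pres_mul.
Proof.
move=> x; rewrite -{2}[x]pres_reprK pres_class_cat.
exact/pres_classP/pres_invl.
Qed.

Lemma pres_mulrV : right_inverse pres_one pres_inv pres_mul.
Proof.
move=> x; rewrite -{1}[x]pres_reprK pres_class_cat.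
exact/pres_classP/pres_invr.
Qed.

HB.instance Definition _ := isGroup.Build presented
  pres_mulA pres_mul1 pres_mulr1 pres_mulV pres_mulrV.

End Presentation.

Definition finitely_presented (G : groupType) : Prop :=
  exists (n : nat) (R : seq (word 'I_n)),
    isomorphic G (presented [set` R]%classic).

Definition free_of_rank (G : groupType) (n : nat) : Prop :=
  isomorphic G (presented (@set0 (word 'I_n))).

(* [a_0, b_0] ... [a_(g-1), b_(g-1)], with a_i = inl i and b_i = inr i. *)
Definition surface_relator (g : nat) : word ('I_g + 'I_g)%type :=
  flatten [seq [:: (inl i, false); (inr i, false);
                   (inl i, true); (inr i, true)] | i <- enum 'I_g].

(* The fundamental group of the closed orientable surface of genus g, through
   its standard one-relator presentation (trivial group for g = 0). *)
Definition surface_group (g : nat) : groupType :=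
  presented [set surface_relator g]%classic.

(* Each geometric edge is listed once, with an orientation; the edge
   homomorphisms are not required to be injective. *)
Record gen_graph_of_groups := GenGraphOfGroups {
  vertex : choiceType;
  edge : choiceType;
  src : edge -> vertex;
  tgt : edge -> vertex;
  vgroup : vertex -> groupType;
  egroup : edge -> groupType;
  src_mor : forall e, {multiplicative egroup e -> vgroup (src e)};
  tgt_mor : forall e, {multiplicative egroup e -> vgroup (tgt e)}
}.

Section SpanningTree.
Variable GG : gen_graph_of_groups.

(* (e, false) traverses e from src e to tgt e, (e, true) backwards. *)
Definition step_from (d : edge GG * bool) : vertex GG :=
  if d.2 then tgt d.1 else src d.1.
Definition step_to (d : edge GG * bool) : vertex GG :=
  if d.2 then src d.1 else tgt d.1.

Fixpoint walk_in (T : set (edge GG)) (u : vertex GG)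
    (p : seq (edge GG * bool)) (v : vertex GG) : Prop :=
  if p is d :: q then [/\ T d.1, step_from d = u & walk_in T (step_to d) q v]
  else u = v.

Definition reduced_walk (p : seq (edge GG * bool)) : bool :=
  sorted (fun d d' => d' != (d.1, ~~ d.2)) p.

Definition is_spanning_tree (T : set (edge GG)) : Prop :=
  forall u v, exists! p, reduced_walk p /\ walk_in T u p v.

Record spanning_tree := SpanningTree {
  tree_edges : set (edge GG);
  tree_edgesP : is_spanning_tree tree_edges
}.

End SpanningTree.

Section FundamentalGroup.
Variables (GG : gen_graph_of_groups) (T : spanning_tree GG).

(* The elements of the vertex groups together with one stable letter for
   each edge. *)
Definition gog_gen : choiceType := ({v : vertex GG & vgroup v} + edge GG)%type.

Definition vgen (v : vertex GG) (x : vgroup v) : gog_gen :=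
  inl (Tagged (@vgroup GG) x).
Definition egen (e : edge GG) : gog_gen := inr e.

(* The relations x . y = xy in every vertex group,
   t_e^-1 alpha_e(x) t_e = beta_e(x) for every edge e, and t_e = 1 for every
   edge e of the spanning tree. *)
Inductive gog_relator : word gog_gen -> Prop :=
| gog_vertex_rel (v : vertex GG) (x y : vgroup v) :
    gog_relator [:: (vgen x, false); (vgen y, false); (vgen (x * y), true)]
| gog_edge_rel (e : edge GG) (x : egroup e) :
    gog_relator [:: (egen e, true); (vgen (src_mor e x), false);
                    (egen e, false); (vgen (tgt_mor e x), true)]
| gog_tree_rel (e : edge GG) :
    tree_edges T e -> gog_relator [:: (egen e, false)].

Definition gog_pi1 : groupType := presented (gog_relator : set _).

End FundamentalGroup.

Section Star.
Variables (I : choiceType) (C : groupType) (F : I -> groupType).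
Variable psi : forall i, {multiplicative C -> F i}.

(* None is the central vertex and Some i the i-th outer one. *)
Definition star_vgroup (v : option I) : groupType :=
  if v is Some i then F i else C.

Definition star : gen_graph_of_groups :=
  @GenGraphOfGroups (option I) I (fun=> None) Some star_vgroup (fun=> C)
    (fun=> (@idfun C : {multiplicative C -> C})) psi.

Lemma star_is_tree : is_spanning_tree (@setT (edge star)).
Proof.
pose out (v : option I) : seq (I * bool) :=
  if v is Some i then [:: (i, false)] else [::].
have cen p v : reduced_walk (GG := star) p ->
    walk_in (GG := star) setT None p v -> p = out v.
  case: p => [_ <- //|[i []] p]; first by move=> _ [].
  case: p => [_ [_ _ /= <-] //|[j []] p]; last by move=> _ [_ _ []].
  rewrite /reduced_walk /= => h [_ _ [_ [ji] _]].
  by move: h; rewrite ji eqxx.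
move=> [i|] v; last first.
  exists (out v); split; last by move=> p [] rp /(cen _ _ rp) ->.
  by case: v => [i|]; split.
have [<-{v}|iv] := eqVneq (Some i : vertex star) v.
  exists [::]; split=> [//|[|[j b] p] [] rp //= [_]].
  case: b rp => rp //= [ji] wp.
  move: (rp); rewrite (cen _ _ (path_sorted rp) wp).
  by rewrite /reduced_walk /= ji eqxx.
exists ((i, true) :: out v); split.
  case: v iv => [j|] iv; split=> //=.
  by rewrite /reduced_walk /= andbT; apply: contra iv => /eqP[->].
case=> [|[j b] p] [] rp /=; first by move=> e; rewrite e eqxx in iv.
case: b rp => rp [_] // [->] wp.
by rewrite (cen _ _ (path_sorted rp) wp).
Qed.

(* The underlying graph is a tree, so its only spanning tree has all edges. *)
Definition star_tree : spanning_tree star := SpanningTree star_is_tree.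

End Star.

(* Main.v *)
(* Write Gamma = < x_i (i < n) | r_j (j < m) > and take g = n + m, calling
   a_i, b_i (i < n) and a'_j, b'_j (j < m) the generators of the surface group.
   Let psi_0, with free target of basis (x_i), send a_i to x_i, b'_j to r_j and
   the other generators to 1, and let psi_1 = psi_2, with free target of rank
   g, kill the b_i and b'_j and send the a_i and a'_j to a basis.  Each handle
   has a generator sent to 1, so the surface relator is respected.  As the maps
   psi_k are onto, the fundamental group of the star is the quotient of the
   surface group by the kernels of the psi_k: the b_i, the b'_j and the a'_j
   die, and b'_j = r_j(a) imposes exactly the relations of Gamma. *)

From HB Require Import structures.
Require Import Defs.
From mathcomp Require Import all_boot.
From mathcomp Require Import boolp classical_sets.

Set Implicit Arguments.
Unset Strict Implicit.
Unset Printing Implicit Defensive.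

Section GroupMorphism.
Local Open Scope group_scope.
Variables (G H : groupType) (F : {multiplicative G -> H}).

(* A multiplicative map carries no unit axiom, so the library lemmas on unital
   morphisms do not apply to it. *)
Lemma multiplicative1 : F 1 = 1.
Proof. by apply: (mulgI (F 1)); rewrite -gmulfM !mulg1. Qed.

Lemma multiplicativeV : {morph F : x / x^-1}.
Proof.
by move=> x; apply/esym/mulg1_eq; rewrite -gmulfM mulgV multiplicative1.
Qed.

End GroupMorphism.

(** * Evaluation of words, and homomorphisms out of a presented group *)

Section WordEval.
Local Open Scope group_scope.
Variable X : choiceType.

Definition word_eval (G : groupType) (f : X -> G) (w : word X) : G :=
  \prod_(a <- w) (if a.2 then (f a.1)^-1 else f a.1).

Lemma word_eval_cat (G : groupType) (f : X -> G) u v :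
  word_eval f (u ++ v) = word_eval f u * word_eval f v.
Proof. exact: big_cat. Qed.

Lemma word_eval1 (G : groupType) (f : X -> G) x :
  word_eval f [:: (x, false)] = f x.
Proof. exact: big_seq1. Qed.

Lemma gmulf_word_eval (G H : groupType) (F : {multiplicative G -> H})
    (f : X -> G) w : F (word_eval f w) = word_eval (F \o f) w.
Proof.
rewrite /word_eval (big_morph F gmulfM (multiplicative1 F)).
apply: eq_bigr => -[x []] _ //=.
exact: multiplicativeV.
Qed.

Lemma eq_word_eval (G : groupType) (f h : X -> G) :
  f =1 h -> word_eval f =1 word_eval h.
Proof. by move=> fh w; apply: eq_bigr => a _; rewrite fh. Qed.

Variable R : set (word X).

Lemma pres_eq_word_eval (G : groupType) (f : X -> G) u v :
  (forall r, R r -> word_eval f r = 1) ->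
  pres_eq R u v -> word_eval f u = word_eval f v.
Proof.
move=> fR; elim=> {u v} // [u v w _ -> _ -> //|u u' v v' _ uu' _ vv'||].
- by rewrite !word_eval_cat uu' vv'.
- move=> [x b]; rewrite /word_eval big_cons big_seq1 big_nil /=.
  by case: b; rewrite ?mulVg ?mulgV.
- by move=> r /fR ->; rewrite /word_eval big_nil.
Qed.

Definition pres_gen (x : X) : presented R := pres_class R [:: (x, false)].

Lemma pres_classM u v :
  pres_class R (u ++ v) = pres_class R u * pres_class R v.
Proof. by rewrite -[RHS]/(pres_mul _ _) pres_class_cat. Qed.

Lemma pres_class_eval w : pres_class R w = word_eval pres_gen w.
Proof.
elim: w => [|a w IH]; first by rewrite /word_eval big_nil.
rewrite -cat1s pres_classM word_eval_cat -IH; congr (_ * _).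
case: a => x [] /=; rewrite /word_eval big_seq1 //=.
apply/esym/mulg1_eq; rewrite -pres_classM; apply/pres_classP.
exact: (pres_cancel R (x, false)).
Qed.

Lemma pres_rel1 r : R r -> pres_class R r = 1.
Proof. by move=> Rr; apply/pres_classP/pres_rel. Qed.

(** Von Dyck's theorem: evaluating a chosen representative is multiplicative because the value
    depends only on the class of the word. *)
Lemma pres_lift (G : groupType) (f : X -> G) :
  (forall r, R r -> word_eval f r = 1) ->
  exists F : {multiplicative presented R -> G},
    forall x, F (pres_gen x) = f x.
Proof.
move=> fR; pose F (x : presented R) := word_eval f (pres_repr x).
have FE w : F (pres_class R w) = word_eval f w.
  exact: pres_eq_word_eval fR (pres_repr_class _ _).
have FM : {morph F : x y / x * y}.
  move=> x y; rewrite -[x]pres_reprK -[y]pres_reprK -pres_classM !FE.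
  exact: word_eval_cat.
pose mF := isMultiplicative.Build _ _ F FM.
pose F' : {multiplicative presented R -> G} := HB.pack F mF.
by exists F' => x; rewrite /= FE word_eval1.
Qed.

Lemma pres_morph_class (G : groupType) (F : {multiplicative presented R -> G})
    w : F (pres_class R w) = word_eval (F \o pres_gen) w.
Proof. by rewrite pres_class_eval gmulf_word_eval. Qed.

Lemma pres_morph_eq (G : groupType) (F H : {multiplicative presented R -> G}) :
  (forall x, F (pres_gen x) = H (pres_gen x)) -> F =1 H.
Proof.
move=> FH x; rewrite -[x]pres_reprK !pres_morph_class.
exact: eq_word_eval.
Qed.

(** Preimages of the generators are picked by choice; a word evaluated at them is a preimage of its
    class. *)
Lemma pres_morph_surj (G : groupType) (F : {multiplicative G -> presented R}) :
  (forall x, exists y, F y = pres_gen x) -> forall z, exists y, F y = z.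
Proof.
move=> /choice[h Fh] z; exists (word_eval h (pres_repr z)).
rewrite gmulf_word_eval -[RHS]pres_reprK pres_class_eval.
exact: eq_word_eval.
Qed.

End WordEval.

Lemma isomorphic_refl (G : groupType) : isomorphic G G.
Proof. by exists idfun; exists id. Qed.

Lemma isomorphic_trans (G H K : groupType) :
  isomorphic G H -> isomorphic H K -> isomorphic G K.
Proof.
move=> [f bf] [h bh]; exists (h \o f); exact: bij_comp bh bf.
Qed.

(** * The fundamental group of a star of groups *)

Section Star.
Local Open Scope group_scope.
Variables (I : choiceType) (C : groupType) (F : I -> groupType).
Variable psi : forall i, {multiplicative C -> F i}.

Notation pi1 := (gog_pi1 (star_tree psi)).

Definition star_incl (v : option I) (x : star_vgroup C F v) : pi1 :=
  pres_gen _ (vgen (GG := star psi) x).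

Lemma star_inclM v : {morph @star_incl v : x y / x * y}.
Proof.
move=> x y; apply/esym/divg1_eq.
have := pres_rel1 (gog_vertex_rel (star_tree psi) (v := v) x y).
by rewrite pres_class_eval /word_eval !big_cons big_nil /= mulg1 mulgA.
Qed.

HB.instance Definition _ v :=
  isMultiplicative.Build _ _ (@star_incl v) (@star_inclM v).

(** Every edge lies in the spanning tree, so the edge relations become plain identifications. *)
Lemma star_egen1 (i : I) : pres_gen _ (egen (GG := star psi) i) = 1 :> pi1.
Proof. exact: pres_rel1 (@gog_tree_rel _ (star_tree psi) i Logic.I). Qed.

Lemma star_incl_psi i x :
  star_incl (v := Some i) (psi i x) = star_incl (v := None) x.
Proof.
apply/esym/divg1_eq.
have := pres_rel1 (gog_edge_rel (star_tree psi) (e := i) x).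
rewrite pres_class_eval /word_eval !big_cons big_nil /= star_egen1.
by rewrite invg1 mul1g mul1g mulg1.
Qed.

(** Since [theta] and the [q i] agree along the edges, they glue to a map [t] from [pi1] to [H]. As
    the [psi i] are onto, the central group already generates [pi1], so it suffices to compare [s]
    and [t] there. *)
Lemma star_pi1_iso (H : groupType) (theta : {multiplicative C -> H})
    (q : forall i, {multiplicative F i -> H}) (s : {multiplicative H -> pi1}) :
  (forall i y, exists x, psi i x = y) ->
  (forall i x, q i (psi i x) = theta x) ->
  (forall h, exists x, theta x = h) ->
  (forall x, s (theta x) = star_incl (v := None) x) ->
  isomorphic H pi1.
Proof.
move=> psi_surj qpsi theta_surj s_theta.
pose vmap (v : option I) : {multiplicative star_vgroup C F v -> H} :=
  if v is Some i then q i else theta.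
pose f (a : gog_gen (star psi)) : H :=
  match a with inl u => vmap (tag u) (tagged u) | inr _ => 1 end.
have [r fr|t tE] := @pres_lift _ (gog_relator (star_tree psi) : set _) H f.
  case: r / fr => [v x y|i x|i _].
  - rewrite /word_eval !big_cons big_nil /= mulg1 gmulfM.
    by rewrite mulgA mulgV.
  - rewrite /word_eval !big_cons big_nil /= qpsi.
    by rewrite invg1 !mul1g mulg1 mulgV.
  - by rewrite word_eval1.
have tC x : t (star_incl (v := None) x) = theta x by rewrite tE.
exists s, t => [h|z].
  by have [x <-] := theta_surj h; rewrite s_theta tC.
(* The generators to check are the outer elements, which come from the centre through [psi i], the
   central ones, and the stable letters, which are trivial. *)
apply: (pres_morph_eq (F := s \o t) (H := idfun)) z => -[[v x]|i] /=.
  rewrite -/(star_incl x).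
  case: v x => [i|] x; last by rewrite tC s_theta.
  by have [y <-] := psi_surj i x; rewrite star_incl_psi tC s_theta.
by rewrite star_egen1 !multiplicative1.
Qed.

Definition star_center : {multiplicative C -> pi1} :=
  (@star_incl None : {multiplicative star_vgroup C F None -> pi1}).

Definition star_outer i : {multiplicative F i -> pi1} :=
  (@star_incl (Some i) : {multiplicative star_vgroup C F (Some i) -> pi1}).

End Star.

(** * Homomorphisms out of surface groups and free groups *)

Section Surface.
Local Open Scope group_scope.

(** Each handle contributes a commutator, trivial as soon as one of its two entries is. *)
Lemma surface_relator_eval1 g (G : groupType) (f : 'I_g + 'I_g -> G) :
  (forall i, f (inl i) = 1 \/ f (inr i) = 1) ->
  word_eval f (surface_relator g) = 1.
Proof.
move=> f1; rewrite /word_eval big_flatten big_map big1 // => i _.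
rewrite !big_cons big_nil /= mulg1.
by case: (f1 i) => ->; rewrite invg1 ?mul1g ?mulg1 mulgV.
Qed.

Lemma surface_lift g (G : groupType) (f : 'I_g + 'I_g -> G) :
  (forall i, f (inl i) = 1 \/ f (inr i) = 1) ->
  exists F : {multiplicative surface_group g -> G},
    forall x, F (pres_gen _ x) = f x.
Proof. by move=> f1; apply: pres_lift => _ ->; apply: surface_relator_eval1. Qed.

Lemma free_lift n (G : groupType) (f : 'I_n -> G) :
  exists F : {multiplicative presented (@set0 (word 'I_n)) -> G},
    forall x, F (pres_gen _ x) = f x.
Proof. by apply: pres_lift. Qed.

End Surface.

(** * The star attached to a finite presentation *)

Section Construction.
Local Open Scope group_scope.
Variables (n : nat) (R : seq (word 'I_n)).
Let m := size R.
Let g := (n + m)%N.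
Let P : groupType := presented [set` R]%classic.
Let free k : groupType := presented (@set0 (word 'I_k)).

(** The first [n] handles belong to the generators x_i and the last [m] to the relators r_j, so maps
    on handles are given blockwise. *)
Let handle (G : groupType) (f : 'I_n -> G) (h : 'I_m -> G) (i : 'I_g) : G :=
  match fintype.split i with inl j => f j | inr j => h j end.

Let handle_l (G : groupType) (f : 'I_n -> G) h j :
  handle f h (lshift m j) = f j.
Proof. by rewrite /handle (unsplitK (inl j)). Qed.

Let handle_r (G : groupType) (f : 'I_n -> G) h j :
  handle f h (rshift n j) = h j.
Proof. by rewrite /handle (unsplitK (inr j)). Qed.

Let a i : surface_group g := pres_gen _ (inl i).
Let b i : surface_group g := pres_gen _ (inr i).

Lemma presented_star_iso :
  exists (F : 'I_3 -> groupType)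
         (psi : forall k : 'I_3, {multiplicative surface_group g -> F k}),
    [/\ forall k : 'I_3, exists2 d : nat, (d <= g)%N & free_of_rank (F k) d,
        forall (k : 'I_3) (y : F k), exists x : surface_group g, psi k x = y
      & isomorphic P (gog_pi1 (star_tree psi))].
Proof.
pose f0 (x : 'I_g + 'I_g) : free n := match x with
  | inl i => handle (pres_gen _) (fun=> 1) i
  | inr i => handle (fun=> 1) (fun j => pres_class _ (tnth (in_tuple R) j)) i
  end.
pose f1 (x : 'I_g + 'I_g) : free g :=
  if x is inl i then pres_gen _ i else 1.
(* This will be the common composite of [p0] with [q0] and of [p1] with [q1]. *)
pose ft (x : 'I_g + 'I_g) : P :=
  if x is inl i then handle (pres_gen _) (fun=> 1) i else 1.
have [i|p0 p0E] := @surface_lift g _ f0.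
  by rewrite /= -[i]splitK; case: fintype.split => j;
     rewrite !(handle_l, handle_r); [right | left].
have [i|p1 p1E] := @surface_lift g _ f1; first by right.
have [i|theta thetaE] := @surface_lift g _ ft; first by right.
have [q0 q0E] := free_lift (pres_gen _ : _ -> P).
have [q1 q1E] := free_lift (handle (pres_gen _ : _ -> P) (fun=> 1)).
have p0_surj y : exists x, p0 x = y.
  apply: pres_morph_surj y => j; exists (a (lshift m j)).
  by rewrite p0E /= handle_l.
have p1_surj y : exists x, p1 x = y.
  by apply: pres_morph_surj y => j; exists (a j); rewrite p1E.
have qp0 : q0 \o p0 =1 theta.
  apply: pres_morph_eq => -[] i; rewrite /= p0E thetaE /= -[i]splitK;
  case: fintype.split => j; rewrite !(handle_l, handle_r) ?multiplicative1 //.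
  (* Only b'_j is left: [p0] sends it to r_j, which is trivial in [P]. *)
  rewrite pres_morph_class (eq_word_eval q0E) -pres_class_eval.
  by apply: pres_rel1; apply: mem_tnth.
have qp1 : q1 \o p1 =1 theta.
  apply: pres_morph_eq => -[] i; rewrite /= p1E thetaE /= ?multiplicative1 //.
pose F (k : 'I_3) := if k == ord0 then free n else free g.
(* The type [F k] itself branches on [k == ord0], hence the dependent return clause. *)
pose psi (k : 'I_3) : {multiplicative surface_group g -> F k} :=
  if k == ord0 as c
    return {multiplicative surface_group g -> if c then free n else free g}
  then p0 else p1.
pose q (k : 'I_3) : {multiplicative F k -> P} :=
  if k == ord0 as c
    return {multiplicative (if c then free n else free g) -> P}
  then q0 else q1.
have psi_surj k y : exists x, psi k x = y.
  by move: y; rewrite /psi /F; case: (k == ord0).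
exists F, psi; split=> //.
  move=> k; rewrite /F; case: (k == ord0).
    by exists n; [exact: leq_addr | exact: isomorphic_refl].
  by exists g => //; exact: isomorphic_refl.
pose iC := star_center psi.
pose i0 : {multiplicative free n -> gog_pi1 (star_tree psi)} :=
  star_outer psi ord0.
(* Index 2 stands for both edges that carry [p1]. *)
pose i1 : {multiplicative free g -> gog_pi1 (star_tree psi)} :=
  star_outer psi ord_max.
have i0E x : i0 (p0 x) = iC x by exact: star_incl_psi psi ord0 x.
have i1E x : i1 (p1 x) = iC x by exact: star_incl_psi psi ord_max x.
have iCb i : iC (b i) = 1 by rewrite -i1E p1E multiplicative1.
have [r /= Rr|s sE] :=
    @pres_lift _ [set` R]%classic _ (fun j => i0 (pres_gen _ j)).
  have [j ->] : exists j, r = tnth (in_tuple R) j.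
    by have /tnthP[j rj] : r \in in_tuple R; [exact: Rr | exists j].
  transitivity (i0 (pres_class _ (tnth (in_tuple R) j))).
    by rewrite pres_morph_class.
  (* Here r_j is the image of b'_j under [p0], and b'_j already dies through [p1]. *)
  by rewrite -[RHS](iCb (rshift n j)) -i0E p0E /= handle_r.
apply: (star_pi1_iso (theta := theta) (q := q) (s := s)) => //.
- by move=> k x; rewrite /q /psi /F; case: (k == ord0); [exact: qp0 | exact: qp1].
- move=> z; apply: pres_morph_surj z => j; exists (a (lshift m j)).
  by rewrite thetaE /= handle_l.
- apply: (pres_morph_eq (F := s \o theta) (H := iC)) => -[] i /=;
    rewrite thetaE /=; last by rewrite -/(b i) iCb multiplicative1.
  (* Read through [p0], a_i becomes x_i, on which [s] is [i0] by definition, and a'_j becomes 1. *)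
  rewrite -/(a i) -i0E p0E /= -[i]splitK; case: fintype.split => j;
  by rewrite !(handle_l, handle_r) ?multiplicative1.
Qed.

End Construction.

Theorem proposition5 (Gamma : groupType) (Gamma_fp : finitely_presented Gamma) :
  exists (g : nat) (F : 'I_3 -> groupType)
         (psi : forall k : 'I_3, {multiplicative surface_group g -> F k}),
    [/\ forall k : 'I_3, exists2 n : nat, (n <= g)%N & free_of_rank (F k) n,
        forall (k : 'I_3) (y : F k), exists x : surface_group g, psi k x = y
      & isomorphic Gamma (gog_pi1 (star_tree psi))].
Proof.
have [n [R GammaR]] := Gamma_fp.
have [F [psi [F_free psi_surj iso]]] := presented_star_iso R.
exists (n + size R)%N, F, psi; split=> //.
exact: isomorphic_trans GammaR iso.
Qed.
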